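(* Let $\Delta$ be a positive integer and let $G$ be a fuzzy long circular interval graph of maximum degree at most $\Delta$. Then $\mathrm{tw}(G)\le 4\Delta+3$.
   Context: Given a graph $H$, a set $F$ of unordered pairs of vertices of $H$ is valid if every vertex of $H$ belongs to at most one member of $F$. A graph $G$ is a thickening of $(H,F)$ if there are nonempty pairwise disjoint sets $X_v\subseteq V(G)$ ($v\in V(H)$) with union $V(G)$ such that: each $X_v$ is a clique; if $uv\in E(H)$ and $\{u,v\}\notin F$ then $X_u$ is complete to $X_v$; if $u,v$ are nonadjacent in $H$ and $\{u,v\}\notin F$ then $X_u$ is anticomplete to $X_v$; if $\{u,v\}\in F$ then $X_u$ is neither complete nor anticomplete to $X_v$. Let $\Sigma$ be a circle and $I_1,\dots,I_k\subseteq\Sigma$ each homeomorphic to $[0,1]$, no two sharing an endpoint, no three with union $\Sigma$. A long circular interval graph is a graph $H$ with $V(H)$ a finite subset of $\Sigma$ in which distinct $u,v$ are adjacent iff $u,v\in I_i$ for some $i$. Let $F'$ be the set of pairs $\{u,v\}$ of distinct vertices of $H$ that are the endpoints of some $I_i$ such that no $j\neq i$ has $u,v\in I_j$, and let $F\subseteq F'$. Any thickening of such $(H,F)$ is a fuzzy long circular interval graph. $\mathrm{tw}$ is treewidth. *)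

(* Defs.v *)
From HB Require Import structures.
From mathcomp Require Import all_boot all_order all_algebra finmap.
From mathcomp Require Import all_classical all_reals all_analysis.
Set Implicit Arguments.
Unset Strict Implicit.
Unset Printing Implicit Defensive.
Import Order.TTheory GRing.Theory Num.Theory.
Import numFieldNormedType.Exports.

Record sgraph := SGraph {
  vertex :> finType;
  adj : rel vertex;
  adj_sym : symmetric adj;
  adj_irr : irreflexive adj
}.

Definition neighbors (G : sgraph) (v : G) : {set G} := [set w | adj v w]%SET.

Definition max_degree (G : sgraph) : nat := \max_(v : G) #|neighbors v|.

Definition clique (G : sgraph) (A : {set G}) : Prop :=
  forall x y, x \in A -> y \in A -> x != y -> adj x y.

Definition complete (G : sgraph) (A B : {set G}) : Prop :=
  forall x y, x \in A -> y \in B -> adj x y.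

Definition anticomplete (G : sgraph) (A B : {set G}) : Prop :=
  forall x y, x \in A -> y \in B -> ~~ adj x y.

Definition connected_graph (G : sgraph) : Prop :=
  forall x y : G, connect (@adj G) x y.

Definition acyclic_graph (G : sgraph) : Prop :=
  forall c : seq G, (2 < size c)%N -> ~~ ucycleb (@adj G) c.

Definition is_tree (G : sgraph) : Prop :=
  [/\ (0 < #|G|)%N, connected_graph G & acyclic_graph G].

Definition induces_connected (G : sgraph) (A : {set G}) : Prop :=
  forall x y, x \in A -> y \in A ->
    connect [rel s t | [&& s \in A, t \in A & adj s t]] x y.

Record tree_decomposition (G T : sgraph) (B : T -> {set G}) : Prop := {
  td_tree : is_tree T;
  td_vertex : forall v : G, exists t, v \in B t;
  td_edge : forall u v : G, adj u v -> exists t, (u \in B t) && (v \in B t);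
  td_connected : forall v : G, induces_connected [set t | v \in B t]%SET
}.

(* Truncated subtraction: the decomposition of the empty graph into empty bags
   has width 0 here rather than -1. *)
Definition td_width (G T : sgraph) (B : T -> {set G}) : nat :=
  (\max_(t : T) #|B t|).-1.

Definition has_td_width (G : sgraph) (w : nat) : Prop :=
  exists (T : sgraph) (B : T -> {set G}),
    tree_decomposition B /\ td_width B = w.

Lemma unit_graph_sym : symmetric (fun _ _ : unit => false).
Proof. by []. Qed.

Lemma unit_graph_irr : irreflexive (fun _ _ : unit => false).
Proof. by []. Qed.

Definition unit_graph : sgraph := SGraph unit_graph_sym unit_graph_irr.

Lemma has_td_width_exists (G : sgraph) : exists w, `[< has_td_width G w >].
Proof.
pose B := fun _ : unit_graph => [set: G]%SET.
exists (td_width B); apply/asboolP; exists unit_graph, B; split => //; split.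
- split; first by rewrite card_unit.
  + by move=> [] [].
  + by move=> [|x [|y [|z c]]].
- by move=> v; exists tt; rewrite finset.in_setT.
- by move=> u v _; exists tt; rewrite !finset.in_setT.
- by move=> v [] [] _ _.
Qed.

Definition treewidth (G : sgraph) : nat := ex_minn (has_td_width_exists G).

(* A set of unordered pairs of vertices is a set of two-element sets. *)
Definition valid_pairs (H : sgraph) (F : {set {set H}}) : Prop :=
  (forall e, e \in F -> #|e| = 2) /\
  (forall (v : H) e e', e \in F -> e' \in F -> v \in e -> v \in e' -> e = e').

Record thickening_by (H : sgraph) (F : {set {set H}}) (G : sgraph)
    (X : H -> {set G}) : Prop := {
  thick_nonempty : forall v, X v != finset.set0;
  thick_disjoint : forall u v, u != v -> [disjoint X u & X v];
  thick_cover : (\bigcup_(v : H) X v)%SET = [set: G]%SET;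
  thick_clique : forall v, clique (X v);
  thick_complete : forall u v, adj u v -> [set u; v]%SET \notin F ->
    complete (X u) (X v);
  thick_anticomplete : forall u v, u != v -> ~~ adj u v ->
    [set u; v]%SET \notin F -> anticomplete (X u) (X v);
  thick_fuzzy : forall u v, u != v -> [set u; v]%SET \in F ->
    ~ complete (X u) (X v) /\ ~ anticomplete (X u) (X v)
}.

Definition thickening (H : sgraph) (F : {set {set H}}) (G : sgraph) : Prop :=
  valid_pairs F /\ exists X : H -> {set G}, thickening_by F X.

Local Open Scope classical_set_scope.
Local Open Scope ring_scope.

Definition homeomorphism (T U : topologicalType) (A : set T) (B : set U)
    (f : T -> U) (g : U -> T) : Prop :=
  [/\ f @` A `<=` B, g @` B `<=` A,
      {in A, cancel f g} /\ {in B, cancel g f},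
      {within A, continuous f} & {within B, continuous g}].

Section Circle.
Variable R : realType.

Definition circle : set (R * R) := [set p | p.1 ^+ 2 + p.2 ^+ 2 = 1].

Definition circle_arc (A : set (R * R)) : Prop :=
  A `<=` circle /\
  exists (f : R -> R * R) (g : R * R -> R),
    @homeomorphism R (R * R)%type `[0, 1] A f g.

Definition endpoint (A : set (R * R)) (p : R * R) : Prop :=
  exists (f : R -> R * R) (g : R * R -> R),
    @homeomorphism R (R * R)%type `[0, 1] A f g /\ (p = f 0 \/ p = f 1).

Definition circular_intervals (k : nat) (I : 'I_k -> set (R * R)) : Prop :=
  [/\ forall i, circle_arc (I i),
      forall i j p, i != j -> endpoint (I i) p -> ~ endpoint (I j) p
    & forall i j l, i != j -> i != l -> j != l ->
        I i `|` I j `|` I l <> circle].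

Section IntervalGraph.
Variables (k : nat) (I : 'I_k -> set (R * R)) (S : {fset (R * R)}).

Definition interval_adj : rel S := fun u v =>
  (u != v) && `[< exists i, I i (val u) /\ I i (val v) >].

Lemma interval_adj_sym : symmetric interval_adj.
Proof.
move=> u v; rewrite /interval_adj eq_sym; congr (_ && _).
by apply/asboolP/asboolP => -[i [? ?]]; exists i.
Qed.

Lemma interval_adj_irr : irreflexive interval_adj.
Proof. by move=> u; rewrite /interval_adj eqxx. Qed.

Definition interval_graph : sgraph := SGraph interval_adj_sym interval_adj_irr.

Definition end_pairs : {set {set interval_graph}} :=
  [set e : {set interval_graph} | `[< exists u v : S,
     [/\ u != v, e = [set u; v]%SET
       & exists i, [/\ endpoint (I i) (val u), endpoint (I i) (val v)
         & forall j, j != i -> ~ (I j (val u) /\ I j (val v))]] >]]%SET.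

End IntervalGraph.

Definition fuzzy_long_circular_interval_graph (G : sgraph) : Prop :=
  exists (k : nat) (I : 'I_k -> set (R * R)) (S : {fset (R * R)})
    (F : {set {set interval_graph I S}}),
    [/\ circular_intervals I, [set` S] `<=` circle,
        F \subset end_pairs I S & thickening F G].

End Circle.

(* Main.v *)
(* Each interval I_i spans a set of vertices of G that two cliques cover, because F is a
   matching; so it has at most 2 (Delta + 1) elements. Cut the circle at a point and order
   the vertices along it: an interval missing the cut point is convex, and one containing it
   has a convex complement. The vertices joined to the start of the order within some
   interval form nested initial segments, so their union C lies in a single interval. Off C
   every interval is convex, and the usual path decomposition of an interval graph, with C
   added to every bag, has bags contained in the union of two intervals. The edges of G
   between the two ends of a pair in F need no special care: some I_i contains both ends. *)
Require Import Defs.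
From mathcomp Require Import all_boot all_order all_algebra.
From mathcomp Require boolp.
Set Implicit Arguments.
Unset Strict Implicit.
Unset Printing Implicit Defensive.

(** * Paths are trees *)

Definition path_adj n : rel 'I_n := fun s t => (s.+1 == t) || (t.+1 == s).

Lemma path_adj_sym n : symmetric (@path_adj n).
Proof. by move=> s t; rewrite /path_adj orbC. Qed.

Lemma path_adj_irr n : irreflexive (@path_adj n).
Proof. by move=> s; rewrite /path_adj orbb; apply/eqP; elim: (s : nat) => // k IH []. Qed.

Definition path_graph n : sgraph := SGraph (@path_adj_sym n) (@path_adj_irr n).

Lemma induces_connected_path n (A : {set path_graph n}) :
  (forall r s t : 'I_n, r \in A -> t \in A -> r <= s <= t -> s \in A) ->
  induces_connected A.
Proof.
move=> convA.
have up d : forall s t : 'I_n, s \in A -> t \in A -> s + d = t ->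
    connect [rel s t : path_graph n | [&& s \in A, t \in A & adj s t]] s t.
  elim: d => [|d IHd] s t sA tA std.
    suff -> : s = t by apply: connect0.
    by apply: val_inj; rewrite /= -std addn0.
  have s1n : s.+1 < n by rewrite (leq_ltn_trans _ (ltn_ord t)) // -std addnS ltnS leq_addr.
  have s1A : Ordinal s1n \in A.
    by apply: (convA s _ t) => //=; rewrite leqnSn -std addnS ltnS leq_addr.
  apply: connect_trans (IHd _ _ s1A tA _); last by rewrite /= addSnnS.
  by apply: connect1; rewrite /= sA s1A /adj /= /path_adj /= eqxx.
move=> s t sA tA.
have [st|ts] := leqP s t; first by apply: (up (t - s)); rewrite ?subnKC.
rewrite sym_connect_sym; first by apply: (up (s - t)); rewrite // subnKC // ltnW.
by move=> x y /=; rewrite path_adj_sym andbCA.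
Qed.

(** Rotate the cycle to start at its largest vertex [m]. The two neighbours of [m] on it, [a] and
    [last b d], must then both be the predecessor of [m], but a cycle of length at least 3 keeps
    them distinct. *)
Lemma acyclic_path n : acyclic_graph (path_graph n).
Proof.
move=> c c3; apply/negP => /andP[cyc uc].
case: c => [//|x0 c] in c3 cyc uc *.
have [m mc mmax] := @arg_maxnP _ x0 (mem (x0 :: c)) (@nat_of_ord n) (mem_head _ _).
have [k d rotc] := rot_to mc.
have memd x : (x \in m :: d) = (x \in x0 :: c) by rewrite -rotc mem_rot.
move: cyc uc c3; rewrite -(rot_cycle k) -(rot_uniq k) -(size_rot k) {}rotc.
case: d memd => [|a [|b d]] //= memd; rewrite rcons_path.
case/and4P=> ma _ _ lm /andP[_ /andP[a_bd _]] _.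
have ac : a \in x0 :: c by rewrite -memd !inE eqxx orbT.
have lbd : last b d \in b :: d by rewrite mem_last.
have lc : last b d \in x0 :: c by rewrite -memd !inE -in_cons lbd !orbT.
have /= am := mmax _ ac; have /= lem := mmax _ lc.
have ea : a.+1 = m :> nat.
  by case/orP: ma => /eqP // e; move: am; rewrite -e ltnn.
have el : (last b d).+1 = m :> nat.
  by case/orP: lm => /eqP // e; move: lem; rewrite -e ltnn.
by case/negP: a_bd; have -> : a = last b d by apply/ord_inj/succn_inj; rewrite ea el.
Qed.

Lemma is_tree_path n : is_tree (path_graph n.+1).
Proof.
split; [by rewrite card_ord | | exact: acyclic_path].
move=> s t.
have conn := @induces_connected_path n.+1 [set: 'I_n.+1].
pose e' : rel 'I_n.+1 :=
  [rel s t | [&& s \in [set: 'I_n.+1], t \in [set: 'I_n.+1] & path_adj s t]].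
rewrite (eq_connect (e' := e')).
  by apply: conn => *; apply: in_setT.
by move=> x y; rewrite /e' /= !in_setT.
Qed.

(** * Path decompositions from sets that are convex or co-convex in a linear order *)

Section IntervalDecomposition.
Variables (G : sgraph) (n : nat) (pos : G -> 'I_n.+1).

Definition convex_set (A : {set G}) := forall x y z,
  x \in A -> z \in A -> pos x <= pos y <= pos z -> y \in A.

Variables (I : finType) (W : I -> {set G}) (m : nat).
Hypothesis W_convex : forall i, convex_set (W i) \/ convex_set (~: W i).
Hypothesis W_card : forall i, #|W i| <= m.
Hypothesis W_vertex : forall x, exists i, x \in W i.
Hypothesis W_edge : forall x y, adj x y -> exists i, (x \in W i) && (y \in W i).

Let initial i : {set G} := [set x | [forall y, (pos y <= pos x) ==> (y \in W i)]].
Let C : {set G} := \bigcup_i initial i.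

(** A vertex [x] outside [C] thus occupies the bags from [pos x] up to the last vertex outside [C]
    that shares some [W i] with it. Requiring [z] outside [C] is what makes [convex_off_initial]
    applicable to the bags. *)
Let reaches x (t : 'I_n.+1) :=
  [exists i, [&& x \in W i, pos x <= t & [exists z in W i :\: C, t <= pos z]]].
Let bag (t : path_graph n.+1) : {set G} := C :|: [set x in ~: C | reaches x t].

Lemma card_initial_union : #|C| <= m.
Proof.
have [i0 _|noI] := pickP I; last by rewrite /C big_pred0 ?cards0.
have [j _ jmax] := @arg_maxnP _ i0 predT (fun i => #|initial i|) isT.
suff -> : C = initial j.
  by apply: leq_trans (W_card j); apply/subset_leq_card/subsetP => x;
     rewrite inE => /forallP/(_ x)/implyP; apply.
apply/eqP; rewrite eqEsubset bigcup_sup // andbT.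
apply/bigcupsP => i _; apply/subsetP => x xi.
apply: contraT => xj.
(* A point of [initial i] outside [initial j] lies at or above all of [initial j], which contradicts
   the maximal size of [initial j]. *)
suff /proper_card : initial j \proper initial i by rewrite ltnNge => /negP[]; apply: jmax.
apply/properP; split; last by exists x.
apply/subsetP => y yj; rewrite inE; apply/forallP => z; apply/implyP => zy.
have yx : pos y <= pos x.
  rewrite leqNgt; apply: contra xj => xy; rewrite inE; apply/forallP => w.
  apply/implyP => wx; move: yj; rewrite inE => /forallP/(_ w)/implyP; apply.
  by apply: leq_trans wx (ltnW xy).
by move: xi; rewrite inE => /forallP/(_ z)/implyP; apply; apply: leq_trans zy yx.
Qed.

(** In the co-convex case, suppose [y] is missing from [W i]. A point at or before [x] that is
    missing too would force [x] out of [W i]. So all of them lie in [W i], which puts [x] in [C]. *)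
Lemma convex_off_initial i x y z : x \in W i -> x \notin C -> z \in W i ->
  y \notin C -> pos x <= pos y <= pos z -> y \in W i.
Proof.
move=> xi xC zi yC /andP[xy yz].
case: (W_convex i) => cvx; first by apply: cvx xi zi _; rewrite xy.
apply: contraNT xC => yi; apply/bigcupP; exists i => //.
rewrite inE; apply/forallP => w; apply/implyP => wx.
apply: contraLR xi => wi; rewrite -in_setC.
by apply: (cvx w _ y); rewrite ?in_setC // wx.
Qed.

(** Outside [C], the leftmost member [x] of the bag and the vertex [z] at or beyond [t] that put it
    there enclose all other members, so the one set [W i] that contains [x] and [z] contains them
    all. *)
Lemma card_bag t : #|bag t| <= 2 * m.
Proof.
rewrite mul2n -addnn; apply: leq_trans (leq_card_setU _ _) _.
apply: leq_add card_initial_union _.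
have [x0 x0t|none] := pickP (mem [set x in ~: C | reaches x t]); last first.
  by rewrite eq_card0.
have [x xt xmin] := @arg_minnP _ x0 _ (fun x => pos x : nat) x0t.
move: (xt); rewrite /= inE in_setC => /andP[xC /existsP[i /and3P[xi xlt /exists_inP[z]]]].
rewrite in_setD => /andP[zC zi] tz.
apply: leq_trans (W_card i); apply/subset_leq_card/subsetP => y yt.
move: (xmin y yt) (yt); rewrite inE in_setC => xy /andP[yC /existsP[j /and3P[_ ylt _]]].
by apply: convex_off_initial xi xC zi yC _; rewrite xy (leq_trans ylt).
Qed.

Lemma mem_bag_reaches i x z : x \in W i -> z \in W i -> z \notin C ->
  pos x <= pos z -> x \in bag (pos z).
Proof.
move=> xi zi zC xz; rewrite !inE; case: (boolP (x \in C)) => //= xC.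
apply/existsP; exists i; rewrite xi xz; apply/exists_inP; exists z => //.
by rewrite in_setD zC.
Qed.

(** An edge fits in the bag at the later of its ends outside [C], and in any bag if both ends are in
    [C]. *)
Lemma bag_decomposition : tree_decomposition bag.
Proof.
split.
- exact: is_tree_path.
- move=> x; have [i xi] := W_vertex x; have [xC|xC] := boolP (x \in C).
    by exists ord0; rewrite in_setU xC.
  by exists (pos x); apply: (mem_bag_reaches xi xi xC).
- move=> x y /W_edge[i /andP[xi yi]].
  have [xC|xC] := boolP (x \in C); have [yC|yC] := boolP (y \in C).
  + by exists ord0; rewrite !in_setU xC yC.
  + by exists (pos y); rewrite in_setU xC (mem_bag_reaches yi yi yC).
  + by exists (pos x); rewrite (mem_bag_reaches xi xi xC) // in_setU yC.
  + have [xy|/ltnW yx] := leqP (pos x) (pos y).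
      by exists (pos y); rewrite (mem_bag_reaches xi yi yC) // (mem_bag_reaches yi yi yC).
    by exists (pos x); rewrite (mem_bag_reaches xi xi xC) // (mem_bag_reaches yi xi xC).
- move=> x; apply: induces_connected_path => r s t.
  rewrite !inE; case: (boolP (x \in C)) => //= xC.
  move=> /existsP[j /and3P[_ xr _]] /existsP[i /and3P[xi _ /exists_inP[z zi tz]]].
  case/andP=> rs st; apply/existsP; exists i; rewrite xi (leq_trans xr rs).
  by apply/exists_inP; exists z; rewrite // (leq_trans st).
Qed.

Lemma treewidth_convex_cover : treewidth G <= (2 * m).-1.
Proof.
rewrite /treewidth; case: ex_minnP => w _ wmin.
apply: leq_trans (wmin (td_width bag) _) _.
  by apply/boolp.asboolP; exists (path_graph n.+1), bag; split; [exact: bag_decomposition|].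
by rewrite /td_width -!subn1 leq_sub2r //; apply/bigmax_leqP => t _; apply: card_bag.
Qed.

End IntervalDecomposition.

(** * Sizes of cliques in a thickening *)

Section Thickening.
Variables (H G : sgraph) (F : {set {set H}}) (X : H -> {set G}).

Lemma card_clique (A : {set G}) : clique A -> #|A| <= (max_degree G).+1.
Proof.
move=> cA; have [->|[x xA]] := set_0Vmem A; first by rewrite cards0.
apply: leq_trans (_ : #|x |: neighbors x| <= _).
  apply/subset_leq_card/subsetP => y yA; rewrite !inE.
  by have [//|xy] := eqVneq y x; apply: cA => //; rewrite eq_sym.
rewrite cardsU1 -add1n leq_add ?leq_b1 //.
exact: (leq_bigmax_cond (F := fun v : G => #|neighbors v|)).
Qed.

Hypothesis thickX : thickening_by F X.

Lemma clique_thick (D : {set H}) : clique D ->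
  {in D &, forall u v, [set u; v] \notin F} -> clique (\bigcup_(v in D) X v).
Proof.
move=> cD noF x y /bigcupP[u uD xu] /bigcupP[v vD yv] xy.
have [uv|uv] := eqVneq u v.
  by apply: (thick_clique thickX) yv xy; rewrite -uv.
exact: (thick_complete thickX (cD _ _ uD vD uv) (noF _ _ uD vD)).
Qed.

(* F is a matching, so one chosen end of every pair of F splits any set of
   vertices into two parts that contain no pair of F. *)
Lemma card_thick_clique (D : {set H}) : valid_pairs F -> clique D ->
  #|\bigcup_(v in D) X v| <= 2 * (max_degree G).+1.
Proof.
case=> F2 Fmatch cD.
pose P := [set v in D | [exists e in F, [pick u in e] == Some v]].
have cut (A : {set H}) : A \subset D -> {in A &, forall u v, [set u; v] \notin F} ->
    #|\bigcup_(v in A) X v| <= (max_degree G).+1.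
  move=> /subsetP sAD noF; apply/card_clique/clique_thick => // u v uA vA.
  by apply: cD; apply: sAD.
have -> : \bigcup_(v in D) X v = \bigcup_(v in P) X v :|: \bigcup_(v in D :\: P) X v.
  rewrite -bigcup_setU; apply: eq_bigl => v.
  by rewrite !inE; case: (v \in D) => //=; rewrite andbT orbN.
apply: leq_trans (leq_card_setU _ _) _; rewrite mul2n -addnn; apply: leq_add.
  apply: cut => [|u v]; first by apply/subsetP => v; rewrite inE => /andP[].
  have chosen e w : e \in F -> [pick u in e] == Some w -> w \in e.
    by case: pickP => // a ae _ /eqP[<-].
  rewrite !inE => /andP[_ /exists_inP[e eF pu]] /andP[_ /exists_inP[e' eF' pv]].
  (* By the matching property [e] and [e'] are both the pair of [u] and [v], whose single chosen end
     would be [u] and [v] at once. *)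
  apply/negP => uvF.
  have eu := Fmatch _ _ _ eF uvF (chosen _ _ eF pu) (set21 _ _).
  have ev := Fmatch _ _ _ eF' uvF (chosen _ _ eF' pv) (set22 _ _).
  move: pu pv; rewrite eu ev => /eqP -> /eqP[uv].
  by have := F2 _ uvF; rewrite uv setUid cards1.
apply: cut => [|u v]; first exact: subsetDl.
(* A pair of [F] inside [D] has its chosen end in [P], so it cannot avoid [P]. *)
rewrite !inE => /andP[uP uD] /andP[vP vD]; apply/negP => uvF.
case E : [pick w in [set u; v]] => [w|]; last first.
  by move: E; case: pickP => // /(_ u); rewrite set21.
have : w \in [set u; v] by move: E; case: pickP => // a a_e [<-].
case/set2P => wE; [move: uP | move: vP]; rewrite ?uD ?vD /= => /exists_inP[];
  by exists [set u; v] => //; rewrite E wE.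
Qed.

End Thickening.

(** The rank counts the strictly smaller keys, so equal keys share a rank. *)
Lemma order_rank (T : finType) d (K : orderType d) (key : T -> K) :
  exists pos : T -> 'I_#|T|.+1,
    forall x y, pos x <= pos y -> (key x <= key y)%O.
Proof.
pose below x := [set u | (key u < key x)%O].
exists (fun x => Ordinal (max_card (below x) : #|below x| < #|T|.+1)) => x y /=.
apply: contraTT; rewrite -Order.TotalTheory.ltNge -ltnNge => yx.
apply/proper_card/properP; split.
  by apply/subsetP => u; rewrite !inE => /Order.POrderTheory.lt_trans; apply.
by exists y; rewrite inE ?Order.POrderTheory.ltxx.
Qed.

From mathcomp Require Import finmap all_classical all_reals all_analysis.
From mathcomp Require Import zify lra.
Import Order.TTheory GRing.Theory Num.Theory.
Import numFieldNormedType.Exports.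
Local Open Scope classical_set_scope.
Local Open Scope ring_scope.

(** * Arcs of the circle under stereographic projection *)

Section Stereographic.
Variable R : realType.
Implicit Types (A : set (R * R)) (p q r s : R * R).

(** This is the intermediate value theorem along a parametrization of the arc; it detects where an
    arc crosses a line. *)
Lemma circle_arc_linear_zero A (a b c : R) p q : circle_arc A -> A p -> A q ->
  a * p.1 + b * p.2 + c <= 0 <= a * q.1 + b * q.2 + c ->
  exists2 s, A s & a * s.1 + b * s.2 + c = 0.
Proof.
case=> _ [f [g [fA gA [_ fgK] cf _]]] Ap Aq /andP[p0 q0].
pose h := (fun t => a * (f t).1 + b * (f t).2 + c).
have ch : {within `[0, 1], continuous h}.
  move=> t; have cft := cf t.
  apply: cvgD; last exact: cvg_cst.
  by apply: cvgD; apply: cvgM; try exact: cvg_cst;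
    apply: (cvg_comp _ _ cft); [exact: cvg_fst | exact: cvg_snd].
have gin s : A s -> g s \in `[0, 1] by move=> As; apply: (gA); exists s.
have fg s : A s -> f (g s) = s by move=> As; apply: fgK; rewrite inE.
have sub (u v : R) : u \in `[0, 1] -> v \in `[0, 1] -> `[u, v] `<=` `[0, 1].
  rewrite !in_itv /= => /andP[u0 _] /andP[_ v1] w /=; rewrite !in_itv /= => /andP[uw wv].
  by rewrite (le_trans u0 uw) (le_trans wv v1).
have [u [u01 hu]] : exists u, u \in `[0, 1] /\ h u = 0.
  have [pq|/ltW qp] := leP (g p) (g q).
    have [||u uI hu] := @IVT R h (g p) (g q) 0 pq.
    - exact: continuous_subspaceW (sub _ _ (gin _ Ap) (gin _ Aq)) ch.
    - by rewrite /h !fg // ge_min p0 le_max q0 orbT.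
    - by exists u; split => //; apply: (sub _ _ (gin _ Ap) (gin _ Aq)).
  have [||u uI hu] := @IVT R h (g q) (g p) 0 qp.
  - exact: continuous_subspaceW (sub _ _ (gin _ Aq) (gin _ Ap)) ch.
  - by rewrite /h !fg // ge_min p0 orbT le_max q0.
  - by exists u; split => //; apply: (sub _ _ (gin _ Aq) (gin _ Ap)).
by exists (f u) => //; apply: fA; exists u.
Qed.

(* Stereographic projection from (1, 0), the centre being sent to -oo. *)
Definition stereo p : \bar R := if p.1 == 1 then -oo%E else (p.2 / (1 - p.1))%:E.

Lemma circle_pole p : circle p -> p.1 = 1 -> p = (1, 0).
Proof.
case: p => x y; rewrite /circle /= => c x1; rewrite x1 in c *; congr pair.
by apply/eqP; rewrite -sqrf_eq0; apply/eqP; lra.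
Qed.

Lemma stereoE p t : p.1 != 1 -> (stereo p = t%:E) <-> (p.2 = t * (1 - p.1)).
Proof.
move=> p1; rewrite /stereo (negbTE p1).
have d : 1 - p.1 != 0 by rewrite subr_eq0 eq_sym.
split=> [[<-]|->]; first by rewrite divfK.
by rewrite mulfK.
Qed.

Lemma stereo_inj : {in @circle R &, injective stereo}.
Proof.
move=> p q; rewrite !inE => cp cq.
have [p1|p1] := eqVneq p.1 1; have [q1|q1] := eqVneq q.1 1.
- by rewrite (circle_pole cp p1) (circle_pole cq q1).
- by rewrite /stereo p1 eqxx (negbTE q1).
- by rewrite /stereo q1 eqxx (negbTE p1).
have dp : 1 - p.1 != 0 by rewrite subr_eq0 eq_sym.
have dq : 1 - q.1 != 0 by rewrite subr_eq0 eq_sym.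
rewrite {2}/stereo (negbTE q1) => /(stereoE _ p1); set t := _ / _ => pt.
have qt : q.2 = t * (1 - q.1) by rewrite divfK.
(* Cancelling [1 - s.1] from the circle equation leaves an equation linear in [s.1], so the slope
   [t] determines the point. *)
have circle_t s : circle s -> 1 - s.1 != 0 -> s.2 = t * (1 - s.1) ->
    1 + s.1 = t ^+ 2 * (1 - s.1).
  by rewrite /circle /= => cs ds st; apply: (mulfI ds); rewrite st in cs; lra.
have ep := circle_t _ cp dp pt; have eq := circle_t _ cq dq qt.
have t1 : 1 + t ^+ 2 != 0 by rewrite gt_eqF // ltr_wpDr ?sqr_ge0.
have pq : p.1 = q.1 by apply: (mulfI t1); lra.
by rewrite [p]surjective_pairing [q]surjective_pairing pt qt pq.
Qed.

Lemma stereo_slope p : p.1 != 1 ->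
  exists2 t, stereo p = t%:E & p.2 = t * (1 - p.1).
Proof.
move=> p1; exists (p.2 / (1 - p.1)); first by rewrite /stereo (negbTE p1).
by rewrite divfK // subr_eq0 eq_sym.
Qed.

Lemma circle_le1 p : circle p -> p.1 <= 1.
Proof. by rewrite /circle /= => c; have := sqr_ge0 p.2; nra. Qed.

(* The line through (1, 0) and q meets the circle only there and at q. *)
Lemma circle_arc_convex A p q r : circle_arc A -> ~ A (1, 0) -> circle q ->
  A p -> A r -> (stereo p <= stereo q <= stereo r)%E -> A q.
Proof.
move=> arcA A1 cq Ap Ar; have Ac := arcA.1.
have offpole s : A s -> s.1 != 1.
  by move=> As; apply/eqP => /(circle_pole (Ac _ As)) e; apply: A1; rewrite -e.
have [tp -> ep] := stereo_slope (offpole _ Ap).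
have [tr -> er] := stereo_slope (offpole _ Ar).
have [q1|q1] := eqVneq q.1 1; first by rewrite /stereo q1 eqxx.
have [t eqt _] := stereo_slope q1; rewrite eqt !lee_fin => /andP[pt qr].
have p1 := circle_le1 (Ac _ Ap); have r1 := circle_le1 (Ac _ Ar).
(* The form [y - t * (1 - x)] changes sign between [p] and [r], because [tp <= t <= tr] and [1 - x]
   is nonnegative on the circle. *)
have [|s As es] := @circle_arc_linear_zero A t 1 (- t) p r arcA Ap Ar.
  by apply/andP; split; nra.
have <- // : s = q; apply: stereo_inj; rewrite ?inE //; first exact: Ac.
by rewrite eqt; apply/stereoE; [exact: offpole | lra].
Qed.

(* On the circle, (1 - x) times the linear form below is the product of
   y - tp (1 - x) and y - tr (1 - x), so it vanishes only at p and r. *)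
Lemma circle_arc_coconvex A p q r : circle_arc A -> A (1, 0) ->
  circle p -> circle q -> circle r ->
  ~ A p -> ~ A r -> (stereo p <= stereo q <= stereo r)%E -> ~ A q.
Proof.
move=> arcA A1 cp cq cr Ap Ar + Aq; have Ac := arcA.1.
have offpole s : circle s -> ~ A s -> s.1 != 1.
  by move=> cs As; apply/eqP => /(circle_pole cs) e; apply: As; rewrite e.
have [tp sp ep] := stereo_slope (offpole _ cp Ap).
have [tr sr er] := stereo_slope (offpole _ cr Ar).
have [q1|q1] := eqVneq q.1 1; first by rewrite {2}/stereo q1 eqxx sp.
have [t eqt et] := stereo_slope q1.
rewrite sp sr eqt !lee_fin => /andP[pt qr].
have q1' : 0 < 1 - q.1 by rewrite subr_gt0 lt_neqAle q1 circle_le1.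
have form s : circle s ->
    (1 - s.1) * ((1 - tp * tr) * s.1 + (- (tp + tr)) * s.2 + (1 + tp * tr)) =
    (s.2 - tp * (1 - s.1)) * (s.2 - tr * (1 - s.1)).
  by rewrite /circle /= => cs; lra.
(* The form equals 2 at the pole. At [q] its product with [1 - q.1] is [(t - tp) * (t - tr)] times a
   square, hence nonpositive. *)
have [|s As es] :=
    @circle_arc_linear_zero A (1 - tp * tr) (- (tp + tr)) (1 + tp * tr) q (1, 0) arcA Aq A1.
  apply/andP; split; last by rewrite /=; lra.
  rewrite -(pmulr_rle0 _ q1') form // et -!mulrBl mulrACA.
  by rewrite mulr_le0_ge0 ?mulr_ge0 ?(ltW q1') // mulr_ge0_le0 ?subr_ge0 ?subr_le0.
have cs := Ac _ As.
have s1 : s.1 != 1.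
  apply/eqP => /(circle_pole cs) e; move: es; rewrite e /=; lra.
have := form s cs; rewrite es mulr0 => /esym/eqP; rewrite mulf_eq0 !subr_eq0.
case/orP => /eqP /(stereoE _ s1); [rewrite -sp | rewrite -sr] => /stereo_inj e.
  by apply: Ap; rewrite -e ?inE.
by apply: Ar; rewrite -e ?inE.
Qed.

End Stereographic.

(** * The bound for fuzzy long circular interval graphs *)

Lemma end_pairs_arc (R : realType) k (I : 'I_k -> set (R * R)) (S : {fset R * R})
    (u v : interval_graph I S) : [set u; v]%SET \in end_pairs I S ->
  exists i, I i (val (u : S)) /\ I i (val (v : S)).
Proof.
rewrite finset.inE => /asboolP[a [b [ab uv [i [ea eb _]]]]]; exists i.
have endpt p : endpoint (I i) p -> I i p.
  case=> f [g [[fI _ _ _ _] [->|->]]]; apply: fI; [exists 0|exists 1] => //;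
  by rewrite /= in_itv /= ?lexx ?ler01.
have mem (w : S) : (w : interval_graph I S) \in [set a; b]%SET -> I i (val w).
  by case/finset.set2P => ->; apply: endpt.
by split; apply: mem; rewrite -uv ?finset.set21 ?finset.set22.
Qed.

Theorem theorem3p3 (R : realType) (Delta : nat) (G : sgraph)
  (hDelta : (0 < Delta)%N)
  (hG : fuzzy_long_circular_interval_graph R G)
  (hdeg : (max_degree G <= Delta)%N) :
  (treewidth G <= 4 * Delta + 3)%N.
Proof.
have [k [I [S [F [[arcI _ _] Scirc /fintype.subsetP sFE [Fvalid [X thX]]]]]]] := hG.
pose point (v : interval_graph I S) : R * R := val (v : S).
have {}Scirc (v : interval_graph I S) : circle (point v)
  by apply: Scirc; apply: (valP (v : S)).
have /fin_all_exists[vx vxP] (x : G) : exists v, x \in X v.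
  have : x \in [set: G]%SET by rewrite finset.in_setT.
  by rewrite -(thick_cover thX) => /finset.bigcupP[v _ xv]; exists v.
have vxE x v : x \in X v -> vx x = v.
  move=> xv; apply/eqP; apply: contraT => ne.
  by have /disjointFr/(_ (vxP x)) := thick_disjoint thX ne; rewrite xv.
have [pos posP] := order_rank (fun x => stereo (point (vx x))).
pose D i := [set v : interval_graph I S | `[< I i (point v) >]]%SET.
(* The sets [X v] join the cover because a vertex of the interval graph may lie on no arc. *)
pose W (j : 'I_k + interval_graph I S) : {set G} :=
  match j with inl i => (\bigcup_(v in D i) X v)%SET | inr v => X v end.
have memW i x : (x \in W (inl i)) = `[< I i (point (vx x)) >].
  apply/finset.bigcupP/idP => [[v vD /vxE ->]|xi]; first by rewrite finset.inE in vD.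
  by exists (vx x); rewrite ?finset.inE.
(* Each covering set has at most [m = 2 * Delta.+1] elements and each bag at most [2 * m]; the width
   is one less. *)
have -> : (4 * Delta + 3 = (2 * (2 * Delta.+1)).-1)%N by lia.
apply: (@treewidth_convex_cover _ _ pos _ W).
- case=> [i|v].
    have [I1|I1] := pselect (I i (1, 0)).
      right=> x y z; rewrite !finset.in_setC !memW.
      move=> /asboolPn xI /asboolPn zI /andP[/posP xy /posP yz]; apply/asboolPn.
      by apply: circle_arc_coconvex xI zI _ => //; rewrite xy.
    left=> x y z; rewrite !memW => /asboolP xI /asboolP zI /andP[/posP xy /posP yz].
    by apply/asboolP; apply: circle_arc_convex xI zI _ => //; rewrite xy.
  (* Both outer keys are the key of [v], so the middle one is too, and [stereo] is injective on the
     circle. *)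
  left=> x y z /vxE xv /vxE zv /andP[/posP xy /posP yz].
  have <- // : vx y = v; apply/val_inj/stereo_inj; rewrite ?inE //.
  by apply/eqP; rewrite eq_le -[in X in X && _]zv -[in X in _ && X]xv; apply/andP.
- have cl : ((max_degree G).+1 <= Delta.+1)%N by [].
  case=> [i|v] /=.
    apply: (leq_trans (card_thick_clique thX Fvalid _)); last by rewrite leq_mul2l.
    move=> u v; rewrite !finset.inE => /asboolP ui /asboolP vi uv.
    by rewrite /adj /= /interval_adj uv; apply/asboolP; exists i.
  apply: (leq_trans (card_clique (@thick_clique _ _ _ _ thX v))).
  by rewrite (leq_trans cl) // leq_pmull.
- by move=> x; exists (inr (vx x)) => /=.
- move=> x y xy.
  have [e|ne] := eqVneq (vx x) (vx y).
    by exists (inr (vx x)); rewrite /= vxP e vxP.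
  suff [i [xi yi]] : exists i, I i (point (vx x)) /\ I i (point (vx y)).
    by exists (inl i); rewrite !memW; apply/andP; split; apply/asboolP.
  have [/andP[_ /asboolP//]|nadj] := boolP (adj (vx x) (vx y)).
  have [/sFE/end_pairs_arc//|nF] := boolP ([set vx x; vx y]%SET \in F).
  by have := thick_anticomplete thX ne nadj nF (vxP x) (vxP y); rewrite xy.
Qed.
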